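(* Let $\sigma$ be a probability measure with $\sigma([0,1])=1$. Fix an integer $k\ge 2$ and let $$\rho:=(k-1)R_\sigma\left(\frac{1}{k+3}\right),\qquad r:=\frac{\rho}{6(k+3)}\left(\frac{\rho}{12e}\right)^{k-1}.$$ Then for each integer $n\ge r^{-1}$ and each $p\in\mathbb{R}^k$ satisfying $$\left|p_j-\int x^j d\sigma(x)\right|\le r,\qquad 1\le j\le k,$$ there exist (not necessarily distinct) $x_1,\dots,x_n\in[0,1]$ satisfying $$\frac1n\sum_{i=1}^n x_i^j=p_j\quad\text{for all integers }1\le j\le k.$$
   Context: For a probability measure $\sigma$ on $\mathbb{R}$ and $0<\delta<1$, $R_\sigma(\delta):=\min\left(|x-y|\ :\ x,y\in\mathbb{R},\ \sigma([x,y])\ge\delta\right)$ (the minimal length of an interval of $\sigma$-probability at least $\delta$). If $r=0$ then $r^{-1}$ is understood as $+\infty$, so that the statement is vacuous in that case. *)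

(* Defs.v *)
From HB Require Import structures.
From mathcomp Require Import all_boot all_order all_algebra.
From mathcomp Require Import all_classical all_reals all_analysis.

Set Implicit Arguments.
Unset Strict Implicit.
Unset Printing Implicit Defensive.

Import Order.TTheory GRing.Theory Num.Theory.

Local Open Scope classical_set_scope.
Local Open Scope ring_scope.

(* For 0 < delta < 1 this infimum is a minimum, over a nonempty set bounded
   below by 0: the endpoints of a minimizing sequence of intervals stay bounded
   (delta > 0), and a limit interval [x, y] still has measure >= delta.
   When y < x the interval is empty, so such pairs do not contribute. *)
Definition min_length (R : realType)
    (sigma : probability (measurableTypeR R) R) (delta : R) : R :=
  inf [set l | exists x y : R,
                 (delta%:E <= sigma `[x, y]%classic)%E /\ l = `|x - y|].

Definition rho (R : realType) (sigma : probability (measurableTypeR R) R)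
    (k : nat) : R :=
  (k%:R - 1) * min_length sigma (k + 3)%:R^-1.

Definition moment_radius (R : realType) (sigma : probability (measurableTypeR R) R)
    (k : nat) : R :=
  rho sigma k / (6 * (k + 3)%:R) * (rho sigma k / (12 * expR 1)) ^+ (k - 1).

(* Main.v *)
(* Let d be the minimal length of an interval of probability at least 1/(k+3),
   and let a_l be the quantile of order l/n.  By monotonicity the empirical
   moments of a_1, ..., a_n are within 1/n <= r of those of sigma, hence within
   2r of p.  With m = ceil(n/(k+3)), the points of index in [m, (k+1)m) split
   into m transversals, each made of k points at mutual distance and distance
   from {0, 1} at least d; it is enough to shift the first k power sums of each
   transversal by a vector c with entries at most e = 2(k+3)r.

   This is done on polynomials: if P = prod (X - y_i), the perturbed power sums
   determine via Newton's identities a monic Q of degree k, close to P.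
   Since P is large and of alternating signs at the points y_i +- d/2, so is Q,
   which therefore has k roots in [0, 1]: these are the new points. *)
Require Import Defs.
From HB Require Import structures.
From mathcomp Require Import all_boot all_order all_algebra.
From mathcomp Require Import all_classical all_reals all_analysis.
From mathcomp Require Import measurable_realfun ring lra zify.

Set Implicit Arguments.
Unset Strict Implicit.
Unset Printing Implicit Defensive.

Import Order.TTheory GRing.Theory Num.Theory.
Import numFieldNormedType.Exports.

Local Open Scope classical_set_scope.
Local Open Scope ring_scope.

(** * Logarithmic derivatives modulo a power of X *)

(* [A^`() + A * S = 0] modulo ['X^n] says that [- S] is the logarithmic
   derivative of [A], so that multiplying the [A] adds the [S]. *)
Lemma logderivM (F : fieldType) n (A B S T : {poly F}) :
  'X^n %| A^`() + A * S -> 'X^n %| B^`() + B * T ->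
  'X^n %| (A * B)^`() + A * B * (S + T).
Proof.
move=> hA hB.
have -> : (A * B)^`() + A * B * (S + T) =
    (A^`() + A * S) * B + A * (B^`() + B * T) by rewrite derivM; ring.
by apply: dvdp_add; [apply: dvdp_mulr | apply: dvdp_mull].
Qed.

(** A nonzero constant term makes [A] coprime to ['X^n], so ['X^n] divides [S - T]. *)
Lemma logderiv_inj (F : fieldType) n (A S T : {poly F}) : A`_0 != 0 ->
  'X^n %| A^`() + A * S -> 'X^n %| A^`() + A * T ->
  forall j, (j < n)%N -> S`_j = T`_j.
Proof.
move=> A0 hS hT j jn; apply/eqP; rewrite -subr_eq0 -coefB.
have : 'X^n %| A * (S - T).
  have -> : A * (S - T) = (A^`() + A * S) - (A^`() + A * T) by ring.
  by rewrite dvdp_sub.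
rewrite Gauss_dvdpr => [/dvdpP[U ->]|]; first by rewrite coefMXn jn.
by rewrite coprimep_expl // coprimep_sym coprimepX rootE horner_coef0.
Qed.

(** For one factor, the geometric sum gives [(1 - w X) * S = w (1 - (w X)^n)], and adding the
    derivative [- w] leaves a multiple of ['X^n]. The factors are then multiplied by [logderivM]. *)
Lemma newton_identities (F : fieldType) (I : Type) (r : seq I) n (w : I -> F) :
  'X^n %| (\prod_(i <- r) (1 - w i *: 'X))^`() +
    (\prod_(i <- r) (1 - w i *: 'X)) * \poly_(j < n) (\sum_(i <- r) w i ^+ j.+1).
Proof.
elim: r => [|a r IH].
  rewrite big_nil mul1r -[1]/(1%:P) derivC add0r poly_def big1 ?dvdp0 // => i _.
  by rewrite big_nil scale0r.
rewrite big_cons.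
have -> : \poly_(j < n) (\sum_(i <- a :: r) w i ^+ j.+1) =
    \poly_(j < n) (w a ^+ j.+1) + \poly_(j < n) (\sum_(i <- r) w i ^+ j.+1).
  by rewrite !poly_def -big_split; apply: eq_bigr => i _; rewrite big_cons scalerDl.
apply: logderivM => //.
have -> : (1 - w a *: 'X)^`() = - (w a)%:P.
  by rewrite derivB -[1]/(1%:P) derivC derivZ derivX sub0r alg_polyC.
have -> : \poly_(j < n) (w a ^+ j.+1) = (w a)%:P * \sum_(i < n) (w a *: 'X) ^+ i.
  rewrite poly_def big_distrr; apply: eq_bigr => i _ /=.
  by rewrite exprS -scalerA -mul_polyC exprZn.
have -> : (1 - w a *: 'X) * ((w a)%:P * \sum_(i < n) (w a *: 'X) ^+ i) =
    - (w a)%:P * ((w a *: 'X) ^+ n - 1) by rewrite subrX1; ring.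
have -> : - (w a)%:P + - (w a)%:P * ((w a *: 'X) ^+ n - 1) =
    - (w a)%:P * (w a *: 'X) ^+ n by ring.
by rewrite exprZn -mul_polyC; do 2 apply: dvdp_mull.
Qed.

(* [D] is the truncation of [exp (- \int C)]; its coefficients are dominated by
   those of [(1 - X) ^ (- e)], which are at most [e]. *)
Lemma logderiv_exists (F : numFieldType) (e : F) (C : {poly F}) n :
  0 <= e <= 1 -> (forall i, `|C`_i| <= e) ->
  exists D : {poly F}, [/\ (size D <= n.+1)%N, D`_0 = 1,
    'X^n %| D^`() + D * C & forall i, (0 < i)%N -> `|D`_i| <= e].
Proof.
move=> /andP[e0 e1] hC; elim: n => [|n [D [sD D0 hD bD]]].
  exists 1; split; rewrite ?size_poly1 ?coef1 ?expr0 ?dvd1p //.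
  by move=> [|i] // _; rewrite coef1 normr0.
(* The new term contributes [n.+1 * a] to the coefficient of degree [n] in the relation; [a] is
   chosen to cancel it. *)
set a : F := - (D * C)`_n / n.+1%:R.
have n0 : n.+1%:R != 0 :> F by rewrite pnatr_eq0.
exists (D + a *: 'X^(n.+1)); split.
- rewrite (leq_trans (size_polyD _ _)) // geq_max (leqW sD) /=.
  by rewrite (leq_trans (size_scale_leq _ _)) // size_polyXn.
- by rewrite coefD coefZ coefXn mulr0 addr0.
- have hj j : (j < n.+1)%N ->
      ((D + a *: 'X^(n.+1))^`() + (D + a *: 'X^(n.+1)) * C)`_j = 0.
    rewrite ltnS leq_eqVlt => hj.
    have Xj : ('X^(n.+1) * C)`_j = 0.
      by rewrite coefXnM ltnS; move: hj; rewrite -leq_eqVlt => ->.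
    rewrite derivD derivZ mulrDl -scalerAl !coefD !coefZ Xj mulr0 addr0.
    rewrite derivXn coefMn coefXn.
    case/orP: hj => [/eqP ->|hj].
      rewrite /= eqxx coef_deriv nth_default ?mul0rn ?add0r //.
      by rewrite /a -[1 *+ _]/(n.+1%:R : F) mulfVK // addNr.
    case/dvdpP: hD => U hU.
    rewrite ltn_eqF //= mul0rn mulr0 addr0 -coefD hU coefMXn hj //.
  rewrite -(poly_take_drop n.+1 (_^`() + _)) dvdp_add ?dvdp_mull //.
  suff -> : take_poly n.+1 ((D + a *: 'X^(n.+1))^`() + (D + a *: 'X^(n.+1)) * C) = 0.
    by rewrite dvdp0.
  by apply/polyP => j; rewrite coef_take_poly coef0; case: ifP => // /hj.
- move=> i i0; rewrite coefD coefZ coefXn.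
  have [->|_] := eqVneq i n.+1; last by rewrite mulr0 addr0 bD.
  rewrite nth_default // add0r mulr1 /a normrM normrN normfV.
  rewrite ler_pdivrMr ?normr_gt0 // normr_nat.
  (* The convolution has [n.+1] terms, each at most [e] because the coefficients of [D] have modulus
     at most 1; the denominator [n.+1] of [a] compensates their number. *)
  rewrite coefM (le_trans (ler_norm_sum _ _ _)) //.
  rewrite mulr_natr -[n.+1 in leRHS]card_ord -sumr_const ler_sum // => j _.
  rewrite normrM -[leRHS]mul1r ler_pM // ?normr_ge0 //.
  case: (nat_of_ord j) => [|l]; first by rewrite D0 normr1.
  by rewrite (le_trans (bD _ _)).
Qed.

(** * Products of linear factors: coefficients and values *)

(** Up to sign, the coefficients are elementary symmetric functions of numbers of modulus at most 1;
    the induction is Pascal's rule. *)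
Lemma coef_prod_1subX_le (R : numDomainType) (I : Type) (r : seq I) (y : I -> R) m :
  (forall i, `|y i| <= 1) ->
  `|(\prod_(i <- r) (1 - y i *: 'X))`_m| <= 'C(size r, m)%:R.
Proof.
move=> hy; elim: r m => [|a r IH] m.
  by rewrite big_nil coef1 bin0n; case: m => [|m]; rewrite ?normr1 ?normr0.
rewrite big_cons mulrBl mul1r coefB -scalerAl coefZ coefXM.
case: m => [|m] /=; first by rewrite mulr0 subr0 !bin0 (le_trans (IH _)) ?bin0.
rewrite binS natrD (le_trans (ler_normB _ _)) // lerD // normrM.
by rewrite -[leRHS]mul1r ler_pM.
Qed.

Lemma size_prod_1subX_le (R : nzRingType) (I : Type) (r : seq I) (y : I -> R) :
  (size (\prod_(i <- r) (1 - y i *: 'X))%R <= (size r).+1)%N.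
Proof.
elim: r => [|a r IH]; first by rewrite big_nil size_poly1.
have aux (l m s : nat) : (l <= 2 -> m <= s.+1 -> (l + m).-1 <= s.+2)%N by lia.
rewrite big_cons (leq_trans (size_polyMleq _ _)) // aux //.
rewrite (leq_trans (size_polyD _ _)) // geq_max size_poly1 size_polyN /=.
by rewrite (leq_trans (size_scale_leq _ _)) // size_polyX.
Qed.

(** Counting each [j] once per larger [i] gives the sum of [(k - j) * 'C(k, j) = k * 'C(k.-1, j)].
    This double sum measures the total coefficient error in [rev_perturb_le]. *)
Lemma sum_sum_bin k : (0 < k)%N ->
  (\sum_(i < k.+1) \sum_(j < i) 'C(k, j) = k * 2 ^ k.-1)%N.
Proof.
move=> k0.
have swap (f : nat -> nat) n :
    (\sum_(i < n.+1) \sum_(j < i) f j = \sum_(j < n) (n - j) * f j)%N.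
  elim: n => [|n IH]; first by rewrite big_ord_recl !big_ord0.
  rewrite big_ord_recr IH /= !big_ord_recr /= subSn // subnn mul1n addnA.
  congr (_ + _)%N; rewrite -big_split; apply: eq_bigr => i _ /=.
  by rewrite subSn 1?ltnW // mulSn addnC.
rewrite swap; case: k k0 => // k _ /=.
rewrite -[2%N]/(1 + 1)%N expnDn big_distrr /=; apply: eq_bigr => j _ /=.
by rewrite !exp1n !muln1 -mul_bin_left -mul_bin_diag.
Qed.

(** On either side of [z] the factors are bounded below in modulus by successive multiples of [b],
    whence the two factorials; the [k - l] points above [z] account for the sign. *)
Lemma prod_subr_ge (R : realDomainType) (b z : R) (y : nat -> R) l k :
  0 <= b -> (l <= k)%N ->
  (forall i, (i < l)%N -> (l - i)%:R * b <= z - y i) ->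
  (forall i, (l <= i < k)%N -> (i - l).+1%:R * b <= y i - z) ->
  b ^+ k * (l`! * (k - l)`!)%:R <= (-1) ^+ (k - l) * \prod_(i < k) (z - y i).
Proof.
move=> b0 lk hl hk.
rewrite -(big_mkord xpredT (fun i => z - y i)) (big_cat_nat_idem _ _ lk) //=; last first.
  exact: mulr1.
set P1 := \prod_(0 <= i < l) _; set P2 := \prod_(l <= i < k) _.
have -> : (-1) ^+ (k - l) * (P1 * P2) = P1 * ((-1) ^+ (k - l) * P2) by ring.
have -> : b ^+ k * (l`! * (k - l)`!)%:R =
    (b ^+ l * l`!%:R) * (b ^+ (k - l) * (k - l)`!%:R).
  by rewrite -{1}(subnKC lk) exprD natrM; ring.
have fact_prod n : b ^+ n * n`!%:R = \prod_(i < n) (i.+1%:R * b).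
  elim: n => [|n IH]; first by rewrite big_ord0 expr0 mul1r.
  by rewrite big_ord_recr /= -IH exprS factS natrM; ring.
have h0 (n : nat) : 0 <= b ^+ n * n`!%:R by rewrite mulr_ge0 ?exprn_ge0.
apply: ler_pM => //.
- rewrite fact_prod (reindex_inj rev_ord_inj) /P1 big_mkord /=.
  apply: ler_prod => i _; rewrite mulr_ge0 //=.
  by rewrite subnSK // hl.
- have -> : P2 = \prod_(0 <= i < k - l) (z - y (i + l)%N).
    by rewrite /P2 -[in LHS](add0n l) big_addn.
  rewrite fact_prod big_mkord.
  have -> : (-1) ^+ (k - l) = \prod_(i < k - l) (-1 : R).
    by rewrite prodr_const card_ord.
  rewrite -big_split /=.
  apply: ler_prod => i _; rewrite mulr_ge0 //= mulN1r opprB.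
  by have := hk (i + l)%N; rewrite addnK; apply; move: (ltn_ord i); lia.
Qed.

(** * Moving power sums *)

(** Reversal passes from products of [1 - y X], suited to Newton's identities, to products of
    [X - y], whose sign changes locate the roots. *)
Lemma horner_rev (F : fieldType) (B : {poly F}) k (x : F) :
  x != 0 -> (size B <= k.+1)%N ->
  (\poly_(i < k.+1) B`_(k - i)).[x] = x ^+ k * B.[x^-1].
Proof.
move=> x0 sB; rewrite horner_poly (horner_coef_wide _ sB) big_distrr /=.
rewrite (reindex_inj rev_ord_inj) /=; apply: eq_bigr => i _.
have ik : (i <= k)%N by rewrite -ltnS.
rewrite subSS subKn // exprVn mulrCA; congr (_ * _).
by apply: (mulIf (expf_neq0 i x0)); rewrite divfK ?expf_neq0 // -exprD subnK.
Qed.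

(** The difference of the two sides has degree at most [k] but vanishes at 0, both constant terms
    being 1, and at the [k] distinct inverses of the [w i]. *)
Lemma prod_1subX_of_roots (F : fieldType) (B : {poly F}) k (w : nat -> F) :
  (size B <= k.+1)%N -> B`_0 = 1 ->
  (forall i j, (i < k)%N -> (j < k)%N -> w i = w j -> i = j) ->
  (forall i, (i < k)%N -> w i != 0 /\ root B (w i)^-1) ->
  B = \prod_(i < k) (1 - w i *: 'X).
Proof.
move=> sB B0 winj hw; apply/eqP; rewrite -subr_eq0; apply/negPn/negP => nz.
pose rs := 0 :: [seq (w i)^-1 | i <- iota 0 k].
have : (size rs < size (B - \prod_(i < k) (1 - w i *: 'X))%R)%N.
  apply: max_poly_roots => //.
  - apply/andP; split.
      rewrite rootE hornerD hornerN horner_coef0 B0 horner_prod big1 ?subrr //.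
      by move=> i _; rewrite !hornerE ?mulr0 ?subr0.
    apply/allP => t /mapP[i]; rewrite mem_iota add0n => /andP[_ ik] ->.
    have [w0 Bw] := hw _ ik.
    rewrite rootE hornerD hornerN (rootP Bw) horner_prod (bigD1 (Ordinal ik)) //=.
    by rewrite !hornerE mulfV // subrr mul0r oppr0.
  - rewrite /rs cons_uniq; apply/andP; split.
      apply/negP => /mapP[i]; rewrite mem_iota add0n => /andP[_ ik] /esym/eqP.
      by rewrite invr_eq0 (negPf (hw _ ik).1).
    rewrite map_inj_in_uniq ?iota_uniq // => i j.
    rewrite !mem_iota !add0n => /andP[_ ik] /andP[_ jk] /invr_inj.
    exact: winj.
rewrite /= size_map size_iota ltnNge => /negP; apply.
rewrite (leq_trans (size_polyD _ _)) // geq_max sB size_polyN.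
by rewrite (leq_trans (size_prod_1subX_le _ _)) // /index_enum -enumT size_enum_ord.
Qed.

(** Powers of [x] are at most 1, so the coefficient errors add up. Since [D] has constant term 1,
    the error in degree [i] involves only the coefficients of the product of degree [j < i], each at
    most ['C(k, j)]. *)
Lemma rev_perturb_le (R : realFieldType) (y : nat -> R) (D : {poly R}) k (e x : R) :
  (0 < k)%N -> (forall i, (i < k)%N -> `|y i| <= 1) -> D`_0 = 1 ->
  (forall i, (0 < i)%N -> `|D`_i| <= e) -> 0 < x <= 1 ->
  `|(\poly_(i < k.+1)
        (take_poly k.+1 (\prod_(i < k) (1 - y i *: 'X) * D))`_(k - i)).[x] -
      \prod_(i < k) (x - y i)|
    <= e * (k * 2 ^ k.-1)%:R.
Proof.
move=> k0 hy D0 hD /andP[x0 x1]; set A := \prod_(i < k) _.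
have xn0 : x != 0 by rewrite gt_eqF.
have sr : size (index_enum 'I_k) = k by rewrite /index_enum -enumT size_enum_ord.
have sA : (size A <= k.+1)%N by rewrite (leq_trans (size_prod_1subX_le _ _)) ?sr.
have -> : \prod_(i < k) (x - y i) = x ^+ k * A.[x^-1].
  rewrite horner_prod -[in x ^+ k](card_ord k) -prodr_const -big_split /=.
  by apply: eq_bigr => i _; rewrite !hornerE mulrBr mulr1 mulrCA mulfV ?mulr1.
rewrite -horner_rev // !horner_poly -sumrB.
rewrite (le_trans (ler_norm_sum _ _ _)) // (reindex_inj rev_ord_inj) /=.
rewrite -sum_sum_bin // natr_sum big_distrr /=; apply: ler_sum => i _.
have ik : (i < k.+1)%N by [].
rewrite subSS subKn // -mulrBl normrM.
have xp : `|x ^+ (k - i)| <= 1.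
  by rewrite ger0_norm ?exprn_ge0 ?(ltW x0) // exprn_ile1 ?(ltW x0).
rewrite coef_take_poly ik coefM big_ord_recr /= subnn D0 mulr1 addrK.
rewrite -[leRHS]mulr1 ler_pM // (le_trans (ler_norm_sum _ _ _)) //.
rewrite natr_sum big_distrr /=; apply: ler_sum => j _.
rewrite normrM mulrC ler_pM // ?hD ?subn_gt0 //.
have := @coef_prod_1subX_le R 'I_k (index_enum 'I_k) (fun i => y i) j
  (fun i => hy _ (ltn_ord i)).
by rewrite sr.
Qed.

Lemma separated_le (R : realDomainType) (d : R) (y : nat -> R) k :
  (forall i, (i.+1 < k)%N -> y i + d <= y i.+1) ->
  forall i j, (i <= j < k)%N -> y i + (j - i)%:R * d <= y j.
Proof.
move=> hy i j /andP[ij]; elim: j ij => [|j IH].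
  by rewrite leqn0 => /eqP -> _; rewrite mul0r addr0.
rewrite leq_eqVlt => /orP[/eqP -> _|ij jk]; first by rewrite subnn mul0r addr0.
rewrite subSn // -natr1 mulrDl mul1r addrA.
by rewrite (le_trans _ (hy _ jk)) // lerD2r IH // ltnW.
Qed.

(** The discarded part is a multiple of ['X^(n.+1)], and derivation loses a single power of ['X]. *)
Lemma logderiv_take (F : fieldType) n (A S : {poly F}) :
  'X^n %| A^`() + A * S -> 'X^n %| (take_poly n.+1 A)^`() + take_poly n.+1 A * S.
Proof.
rewrite -{1 2}(poly_take_drop n.+1 A).
move: (take_poly _ A) (drop_poly _ A) => B V.
rewrite derivD mulrDl addrACA dvdp_addl //.
rewrite derivM derivXn /= -mulr_natr exprSr.
apply: dvdp_add; last by apply/dvdp_mulr/dvdp_mull/dvdp_mulr.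
by apply: dvdp_add; apply: dvdp_mull; apply: dvdp_mulr.
Qed.

(** Multiplying by a [D] whose logarithmic derivative is [- C] modulo ['X^k] adds [c] to the power
    sums, and truncation to degree [k] preserves the first [k] of them. The last hypothesis keeps
    the perturbation below the original polynomial at [k + 1] separating points, so that the new
    roots are real and in the unit interval. *)
Lemma move_power_sums (R : rcfType) k (d e : R) (y c : nat -> R) :
  (0 < k)%N -> 0 < d -> d <= y 0%N -> y k.-1 + d <= 1 ->
  (forall i, (i.+1 < k)%N -> y i + d <= y i.+1) ->
  0 <= e <= 1 -> (forall i, (i < k)%N -> `|c i| <= e) ->
  (forall l, (l <= k)%N ->
    e * (k * 2 ^ k.-1)%:R < (d / 2) ^+ k * (l`! * (k - l)`!)%:R) ->
  exists w : nat -> R, (forall i, (i < k)%N -> 0 <= w i <= 1) /\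
    forall j, (j < k)%N ->
      \sum_(i < k) w i ^+ j.+1 = \sum_(i < k) y i ^+ j.+1 + c j.
Proof.
move=> k0 d0 hy0 hy1 hgap /andP[e0 e1] hc hprod.
have hsep := separated_le hgap.
have C_le i : `|(\poly_(j < k) c j)`_i| <= e.
  by rewrite coef_poly; case: ifP => [/hc //|_]; rewrite normr0.
have [D [sD D0 hD bD]] := logderiv_exists k (introT andP (conj e0 e1)) C_le.
have y_ge i : (i < k)%N -> d <= y i.
  move=> ik; rewrite (le_trans hy0) // (le_trans _ (hsep 0%N i _)) //.
  by rewrite lerDl mulr_ge0 // ltW.
have y_le i : (i < k)%N -> y i <= 1 - d.
  move=> ik; rewrite lerBrDr (le_trans _ hy1) // lerD2r.
  rewrite (le_trans _ (hsep i k.-1 _)) //; last by move: ik k0; clear; lia.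
  by rewrite lerDl mulr_ge0 // ltW.
(* The [z l] interlace with the nodes, [z 0 < y 0 < z 1 < ... < y k.-1 < z k], at distance at least
   [d / 2] from each of them. *)
pose z l := if l is l'.+1 then y l' + d / 2 else y 0%N - d / 2.
have z_in l : (l <= k)%N -> 0 < z l <= 1.
  case: l => [|l] lk /=; first by have := y_le _ k0; lra.
  by have := y_le _ lk; have := y_ge _ lk; lra.
have z_lt l : (l < k)%N -> z l < z l.+1.
  by case: l => [|l] lk /=; [lra | have := hgap _ lk; lra].
set A := \prod_(i < k) (1 - y i *: 'X).
set B := take_poly k.+1 (A * D).
set q := \poly_(i < k.+1) B`_(k - i).
(* At [z l] the original product has sign [(-1) ^+ (k - l)] and exceeds the perturbation in modulus,
   so [q] keeps that sign. *)
have q_sign l : (l <= k)%N -> 0 < (-1) ^+ (k - l) * q.[z l].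
  move=> lk.
  have y_norm i : (i < k)%N -> `|y i| <= 1.
    by move=> ik; rewrite ler_norml; have := y_ge _ ik; have := y_le _ ik; lra.
  have hqP := rev_perturb_le k0 y_norm D0 bD (z_in _ lk).
  rewrite -/A -/B -/q in hqP; set P := \prod_(i < k) _ in hqP.
  have hP : (d / 2) ^+ k * (l`! * (k - l)`!)%:R <= (-1) ^+ (k - l) * P.
    apply: prod_subr_ge => // {P hqP}.
    - by rewrite divr_ge0 // ltW.
    - case: l lk => // l lk i; rewrite ltnS => il.
      have := hsep i l; rewrite il lk subSn // -natr1 /= => /(_ isT).
      have : 0 <= (l - i)%:R * d by rewrite mulr_ge0 // ltW.
      lra.
    - move=> i /andP[li ik]; case: l lk li => [|l] lk li /=.
        have := hsep 0%N i; rewrite ik subn0 -natr1 /= => /(_ isT).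
        have : 0 <= i%:R * d by rewrite mulr_ge0 // ltW.
        lra.
      have := hsep l i; rewrite ik (ltnW li) /= => /(_ isT).
      rewrite subnSK //.
      have : 1 * d <= (i - l)%:R * d by rewrite ler_pM2r // ler1n subn_gt0.
      lra.
  have : `|(-1) ^+ (k - l) * q.[z l] - (-1) ^+ (k - l) * P| <= e * (k * 2 ^ k.-1)%:R.
    by rewrite -mulrBr normrM normrX normrN1 expr1n mul1r.
  rewrite ler_norml => /andP[hq _]; have := hprod _ lk; lra.
(* The sign change gives a root, interior because [q] does not vanish at the endpoints. Beyond [k]
   the value is arbitrary: [choice] needs a total function. *)
have w_ex l : exists x, (l < k)%N -> z l < x < z l.+1 /\ root q x.
  have [lk|] := boolP (l < k)%N; last by exists 0.
  have := q_sign _ (ltnW lk); have := q_sign _ lk.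
  rewrite -(subnSK lk) exprS mulN1r mulNr oppr_gt0 => h1 h0.
  have [||x /andP[x1 x2] qx] := @poly_ivt R ((-1) ^+ (k - l.+1) *: q) (z l) (z l.+1).
  - by rewrite ltW // z_lt.
  - by rewrite !hornerZ !ltW.
  exists x => _; move: qx; rewrite rootZ ?signr_eq0 // => qx; split => //.
  rewrite !lt_neqAle x1 x2 !andbT; apply/andP; split; apply/eqP => ex.
    by move: h0; rewrite ex (rootP qx) mulr0 ltxx.
  by move: h1; rewrite -ex (rootP qx) mulr0 ltxx.
have [w hw] := choice w_ex.
have w_in i : (i < k)%N -> 0 < w i <= 1.
  move=> ik; have [/andP[h1 h2] _] := hw _ ik.
  have /andP[h3 _] := z_in i (ltnW ik); have /andP[_ h4] := z_in _ ik; lra.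
have w_lt i j : (i < j < k)%N -> w i < w j.
  move=> /andP[ij jk].
  have [/andP[_ h1] _] := hw _ (ltn_trans ij jk).
  have [/andP[h2 _] _] := hw _ jk.
  rewrite (lt_trans h1) // (le_lt_trans _ h2) //.
  elim: j ij jk {h2} => // j IH; rewrite ltnS leq_eqVlt => /orP[/eqP -> //|ij jk].
  by rewrite (le_trans (IH ij (ltnW jk))) // ltW // z_lt // ltnW.
have w_inj i j : (i < k)%N -> (j < k)%N -> w i = w j -> i = j.
  move=> ik jk eij; case: (ltngtP i j) => // ij.
    by have := w_lt i j; rewrite ij jk eij ltxx => /(_ isT).
  by have := w_lt j i; rewrite ij ik eij ltxx => /(_ isT).
have sB : (size B <= k.+1)%N by exact: size_take_poly.
have B0 : B`_0 = 1.
  rewrite coef_take_poly /= coefM big_ord_recl big_ord0 addr0 subnn D0 mulr1.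
  rewrite -horner_coef0 horner_prod big1 // => i _.
  by rewrite !hornerE ?mulr0 ?subr0.
(* As [q] is the reversal of [B], the inverses of its roots are roots of [B]. *)
have hBw : B = \prod_(i < k) (1 - w i *: 'X).
  apply: prod_1subX_of_roots => // i ik.
  have /andP[wi0 _] := w_in _ ik; have w0 : w i != 0 by rewrite gt_eqF.
  split=> //; have [_ /rootP] := hw _ ik; rewrite horner_rev // => /eqP.
  by rewrite mulf_eq0 expf_eq0 (negPf w0) andbF.
have hA := newton_identities (index_enum 'I_k) k (fun i : 'I_k => y i).
have hB := newton_identities (index_enum 'I_k) k (fun i : 'I_k => w i).
rewrite -hBw in hB; rewrite -/A in hA.
(* [B] now satisfies two relations, one inherited from [A * D] and one from the roots [w i];
   comparing them identifies the power sums. *)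
have hAD := logderivM hA hD.
have hB' : 'X^k %| B^`() +
    B * (\poly_(j < k) (\sum_(i < k) y i ^+ j.+1) + \poly_(i < k) c i).
  exact: logderiv_take.
exists w; split=> [i ik|j jk]; first by have := w_in _ ik; lra.
have := logderiv_inj _ hB hB' jk; rewrite B0 oner_eq0 => /(_ isT).
by rewrite coefD !coef_poly jk.
Qed.

(** * Numerical estimates *)

(** From [j] to [j + 1] the left-hand side is multiplied by [(j + 1) / e] times [(1 + 1/j)^j], and
    the latter power is at most [e]. *)
Lemma expn_div_expR_le_fact (R : realType) j :
  (j%:R / expR 1) ^+ j <= j`!%:R :> R.
Proof.
elim: j => [|j IH]; first by rewrite expr0.
have E0 : (0 : R) < expR 1 by exact: expR_gt0.
have [->|j0] := posnP j.
  by rewrite expr1 ler_pdivrMr // !mul1r (le_trans _ (expR_ge1Dx _)) // lerDl.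
have jp : (0 : R) < j%:R by rewrite ltr0n.
have step : (j.+1%:R / j%:R) ^+ j <= expR 1 :> R.
  have -> : expR 1 = expR j%:R^-1 ^+ j :> R by rewrite -expRM_natl mulfV // gt_eqF.
  rewrite lerXn2r // ?nnegrE ?expR_ge0 ?divr_ge0 //.
  rewrite (le_trans _ (expR_ge1Dx _)) // -natr1 mulrDl mulfV ?gt_eqF //.
  by rewrite mul1r.
have -> : (j.+1%:R / expR 1) ^+ j.+1 =
    (j.+1%:R / expR 1) * ((j.+1%:R / j%:R) ^+ j * (j%:R / expR 1) ^+ j) :> R.
  by rewrite exprS -exprMn; congr (_ * _ ^+ _); field; rewrite !gt_eqF.
rewrite factS natrM.
have -> : j.+1%:R / expR 1 * ((j.+1%:R / j%:R) ^+ j * (j%:R / expR 1) ^+ j) =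
  j.+1%:R * (((j.+1%:R / j%:R) ^+ j / expR 1) * (j%:R / expR 1) ^+ j) :> R by ring.
rewrite ler_pM2l ?ltr0n // -[leRHS]mul1r.
apply: ler_pM => //; rewrite ?divr_ge0 ?exprn_ge0 ?divr_ge0 ?expR_ge0 //.
by rewrite ler_pdivrMr // mul1r.
Qed.

Lemma bin_le_expn j l : ('C(j.+1, l) <= 2 ^ j)%N.
Proof.
elim: j l => [|j IH] [|l] //; first by case: l => [|[|l]].
  by rewrite bin0 expn_gt0.
by rewrite binS expnS mul2n -addnn leq_add.
Qed.

(** This is what [fact_mul_gt] reduces to once powers are cancelled. The left-hand side grows by
    [2 (j + 1) / j], which is at most 3 from [j = 2] on. *)
Lemma mul_expn_lt j : (j * 2 ^ j.+1 < 3 ^ j.+1)%N.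
Proof.
elim: j => [|j IH] //; have [j1|j1] := leqP j 1.
  by move: j1; case: j {IH} => [|[|]].
by rewrite expnS [in X in (_ < X)%N]expnS; move: IH j1; move: (2 ^ _)%N (3 ^ _)%N; nia.
Qed.

(* With [k = j + 1] and [rho = j d], the left-hand side is [k 2 ^ (k - 1)] times
   [2 (k + 3)] times the radius of the theorem; the factor [k 2 ^ (k - 1)] comes
   from [rev_perturb_le]. *)
Lemma fact_mul_gt (R : realType) (d : R) j l : 0 < d -> (l <= j.+1)%N ->
  j%:R * d / 3 * (j%:R * d / (12 * expR 1)) ^+ j * (j.+1 * 2 ^ j)%:R <
  (d / 2) ^+ j.+1 * (l`! * (j.+1 - l)`!)%:R.
Proof.
move=> d0 lj; have E0 : (0 : R) < expR 1 by exact: expR_gt0.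
have -> : j%:R * d / 3 * (j%:R * d / (12 * expR 1)) ^+ j * (j.+1 * 2 ^ j)%:R =
    d ^+ j.+1 * j.+1%:R * ((j%:R / 3 / 6 ^+ j) * (j%:R / expR 1) ^+ j).
  have -> : j%:R * d / (12 * expR 1) = (j%:R / expR 1) * d / 6 / 2.
    by field; rewrite gt_eqF.
  rewrite !exprMn natrM natrX exprS !exprVn; field.
  by rewrite gt_eqF // !expf_neq0.
have fle : (j.+1`!%:R / 2 ^+ j <= (l`! * (j.+1 - l)`!)%:R :> R).
  rewrite ler_pdivrMr ?exprn_gt0 // -(bin_fact lj) -natrX -natrM ler_nat.
  by rewrite mulnC leq_mul // bin_le_expn.
apply: (@lt_le_trans _ _ ((d / 2) ^+ j.+1 * (j.+1`!%:R / 2 ^+ j))); last first.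
  by rewrite ler_pM2l // exprn_gt0 // divr_gt0.
have -> : (d / 2) ^+ j.+1 * (j.+1`!%:R / 2 ^+ j) =
    d ^+ j.+1 * j.+1%:R * (j`!%:R / (2 ^+ j.+1 * 2 ^+ j)).
  by rewrite exprMn exprVn factS natrM; field; rewrite !expf_neq0.
rewrite ltr_pM2l ?mulr_gt0 ?exprn_gt0 // ?ltr0n //.
(* The exponential is removed by [expn_div_expR_le_fact]; the factorial then cancels on both
   sides. *)
apply: (@le_lt_trans _ _ (j%:R / 3 / 6 ^+ j * j`!%:R)).
  rewrite ler_wpM2l ?expn_div_expR_le_fact // !divr_ge0 // exprn_ge0.
rewrite mulrC ltr_pM2l ?ltr0n ?fact_gt0 //.
rewrite ltr_pdivrMr ?exprn_gt0 // ltr_pdivlMl ?mulr_gt0 ?exprn_gt0 //.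
have -> : 6 ^+ j = 2 ^+ j * 3 ^+ j :> R by rewrite -exprMn; congr (_ ^+ _); ring.
rewrite -subr_gt0.
have -> : 2 ^+ j * 3 ^+ j - 2 ^+ j.+1 * 2 ^+ j * (j%:R / 3) =
  2 ^+ j / 3 * ((3 ^ j.+1)%:R - (j * 2 ^ j.+1)%:R) :> R.
  by rewrite natrM !natrX !exprS; field.
by rewrite mulr_gt0 ?divr_gt0 ?exprn_gt0 // subr_gt0 ltr_nat mul_expn_lt.
Qed.

(** * Quantiles *)

Lemma le_probability_cat (R : realType) (P : probability (measurableTypeR R) R)
    (a b c : R) :
  (P `[a, c]%classic <= P `[a, b]%classic + P `]b, c]%classic)%E.
Proof.
rewrite (le_trans _ (measureU2 _ _ _)) //; apply: le_measure; rewrite ?inE //.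
  exact: measurableU.
move=> x /=; rewrite !in_itv /= => /andP[-> ->] /=.
by case: (leP x b); [left|right].
Qed.

(** The quantile is the supremum of the [x] in the unit interval whose tail [[x, 1]] has mass at
    least [1 - u]. Continuity from above gives the bound for the closed tail, continuity from below
    the one for the open tail. *)
Lemma exists_quantile (R : realType) (P : probability (measurableTypeR R) R) (u : R) :
  P `[0, 1]%classic = 1%E -> 0 <= u <= 1 ->
  exists q : R, [/\ 0 <= q <= 1, ((1 - u)%:E <= P `[q, 1%R]%classic)%E &
    (P `]q, 1%R]%classic <= (1 - u)%:E)%E].
Proof.
move=> P01 /andP[u0 u1].
pose E := [set x : R | 0 <= x <= 1 /\ ((1 - u)%:E <= P `[x, 1%R]%classic)%E].
have E0 : E 0 by split; [lra | rewrite P01 lee_fin; lra].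
have ubE : has_ubound E by exists 1 => x [/andP[]].
have supE : has_sup E by split=> //; exists 0.
have E_le x : E x -> x <= sup E by apply: ub_le_sup.
have q01 : 0 <= sup E <= 1.
  by rewrite E_le //= ge_sup // => [|x [/andP[]] //]; exists 0.
exists (sup E); split => //.
- have -> : `[sup E, 1]%classic = \bigcap_n `[sup E - n.+1%:R^-1, 1]%classic :> set R.
    apply/seteqP; split=> x /=.
      rewrite in_itv /= => /andP[x1 x2] n _ /=; rewrite in_itv /= x2 andbT.
      by rewrite (le_trans _ x1) // lerBlDr lerDl invr_ge0.
    move=> hx; rewrite in_itv /=; have := hx 0%N I; rewrite /= in_itv /= => /andP[_ ->].
    rewrite andbT; apply/ler_addgt0Pl => e e0; rewrite -lerBlDl.
    have := hx (Num.truncn e^-1) I; rewrite /= in_itv /= => /andP[hx1 _].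
    rewrite (le_trans _ hx1) // lerB // invf_ple ?posrE //.
    by apply/ltW/truncnS_gt.
  apply: (cvge_to_ge (@nonincreasing_cvg_mu _ _ _ P _ _ _ _ _)).
  + by rewrite (le_lt_trans (probability_le1 _ _)) // ltry.
  + by [].
  + exact: bigcap_measurable.
  + apply/nonincreasing_seqP => n; apply/subsetPset => x /=.
    rewrite !in_itv /= => /andP[h ->]; rewrite andbT (le_trans _ h) // lerB //.
    by rewrite lef_pV2 ?posrE // ler_nat.
  + apply: nearW => n /=.
    have n0 : 0 < n.+1%:R^-1 :> R by rewrite invr_gt0 ltr0n.
    have [x [_ Ex] xn] := sup_adherent n0 supE.
    rewrite (le_trans Ex) // le_measure ?inE // => y /=.
    by rewrite !in_itv /= => /andP[xy ->]; rewrite andbT (le_trans (ltW xn)).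
- rewrite itv_open_bnd_bigcup.
  apply: (cvge_to_le (@nondecreasing_cvg_mu _ _ _ P _ _ _ _)).
  + by [].
  + exact: bigcup_measurable.
  + apply/nondecreasing_seqP => n; apply/subsetPset => x /=.
    rewrite !in_itv /= => /andP[h ->]; rewrite andbT (le_trans _ h) // lerD2l //.
    by rewrite lef_pV2 ?posrE // ler_nat.
  + apply: nearW => n /=.
    have [n1|n1] := leP (sup E + n.+1%:R^-1) 1; last first.
      by rewrite set_itv_ge ?measure0 ?lee_fin ?subr_ge0 // bnd_simp -ltNge.
    rewrite leNgt; apply/negP => /ltW hn.
    have : E (sup E + n.+1%:R^-1).
      by split => //; rewrite n1 andbT addr_ge0 ?invr_ge0 //; case/andP: q01.
    by move/E_le; rewrite gerDl leNgt invr_gt0 ltr0n.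
Qed.

Lemma min_length_le (R : realType) (P : probability (measurableTypeR R) R)
    (delta x y : R) :
  (delta%:E <= P `[x, y]%classic)%E -> min_length P delta <= `|x - y|.
Proof.
move=> h; apply: ge_inf; last by exists x, y.
by exists 0 => l [a [b [_ ->]]].
Qed.

Lemma min_length_ge0 (R : realType) (P : probability (measurableTypeR R) R) (delta : R) :
  0 <= min_length P delta.
Proof.
rewrite /min_length; set S := [set l | _].
have [->|/set0P S0] := eqVneq S set0; first by rewrite inf0.
by apply: lb_le_inf => // l [a [b [_ ->]]].
Qed.

(** * Comparing an integral with averages over quantiles *)

(** The increments that are kept telescope to the value of [f] at the first [b l] not below [x]. *)
Lemma le_step_sum (R : realDomainType) (f : R -> R) (b : nat -> R) m (x : R) :
  (forall s t, s <= t -> 0 <= s -> t <= 1 -> f s <= f t) ->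
  (forall i, 0 <= b i <= 1) -> (forall i, b i <= b i.+1) -> 0 <= x <= b m ->
  f x <= f (b 0%N) + \sum_(l < m) (f (b l.+1) - f (b l)) * (b l < x)%R%:R.
Proof.
move=> hf hb b_nd /andP[x0]; elim: m => [|m IH] xm.
  by rewrite big_ord0 addr0 hf //; case/andP: (hb 0%N).
have [xb|xb] := leP x (b m).
  rewrite big_ord_recr /= (ltNge (b _)) xb /= mulr0 addr0; exact: IH.
have b_homo : {homo b : i j / (i <= j)%N >-> i <= j}.
  by apply: homo_leq => //; exact: le_trans.
rewrite (eq_bigr (fun l : 'I_m.+1 => f (b l.+1) - f (b l))); last first.
  move=> l _; rewrite (le_lt_trans _ xb) ?mulr1 // b_homo //.
  by rewrite -ltnS.
rewrite -(big_mkord xpredT (fun l => f (b l.+1) - f (b l))) telescope_sumr //.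
by rewrite addrC subrK hf //; case/andP: (hb m.+1).
Qed.

(** The increments that are kept telescope to the value of [f] at the last [b l], [l <= m], not
    above [x]. *)
Lemma ge_step_sum (R : realDomainType) (f : R -> R) (b : nat -> R) m (x : R) :
  (forall s t, s <= t -> 0 <= s -> t <= 1 -> f s <= f t) ->
  (forall i, 0 <= b i <= 1) -> (forall i, b i <= b i.+1) -> b 0%N <= x <= 1 ->
  f (b 0%N) + \sum_(l < m) (f (b l.+1) - f (b l)) * (b l.+1 <= x)%R%:R <= f x.
Proof.
move=> hf hb b_nd /andP[x0 x1]; elim: m => [|m IH].
  by rewrite big_ord0 addr0 hf //; case/andP: (hb 0%N).
have [xb|xb] := ltP x (b m.+1).
  by rewrite big_ord_recr /= (leNgt (b _)) xb /= mulr0 addr0.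
have b_homo : {homo b : i j / (i <= j)%N >-> i <= j}.
  by apply: homo_leq => //; exact: le_trans.
rewrite (eq_bigr (fun l : 'I_m.+1 => f (b l.+1) - f (b l))); last first.
  by move=> l _; rewrite (le_trans _ xb) ?mulr1 // b_homo.
rewrite -(big_mkord xpredT (fun l => f (b l.+1) - f (b l))) telescope_sumr //.
by rewrite addrC subrK hf //; case/andP: (hb m.+1).
Qed.

(** Summation by parts. For [c = 1 / m] the term in [g m] vanishes, and adding [g 0] leaves the mean
    of [g 0, ..., g m.-1]. *)
Lemma abel_sum (R : comPzRingType) (g : nat -> R) (c : R) m :
  \sum_(l < m) (g l.+1 - g l) * (1 - l.+1%:R * c) =
    g m * (1 - m%:R * c) - g 0%N + c * \sum_(l < m) g l.
Proof.
elim: m => [|m IH]; first by rewrite !big_ord0; ring.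
by rewrite !big_ord_recr /= IH; ring.
Qed.

Lemma integral_step d (T : measurableType d) (R : realType) (P : probability T R)
    (D : set T) (c : R) m (g : nat -> R) (A : nat -> set T) :
  measurable D -> P D = 1%E -> 0 <= c -> (forall l, 0 <= g l) ->
  (forall l, measurable (A l)) ->
  (\int[P]_(x in D) (c + \sum_(l < m) g l * \1_(A l) x)%:E =
   c%:E + \sum_(l < m) (g l)%:E * P (A l `&` D))%E.
Proof.
move=> mD PD c0 g0 mA.
have mg l : measurable_fun D (EFin \o (fun x => g l * \1_(A l) x)).
  apply/measurable_EFinP; apply: measurable_funM; first exact: measurable_cst.
  exact: measurable_indic.
under eq_integral do rewrite EFinD -sumEFin.
rewrite ge0_integralD //=; last 2 first.
- by move=> x _; apply: sume_ge0 => l _; rewrite lee_fin mulr_ge0 // /indic ler0n.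
- by apply: emeasurable_sum => l; exact: mg.
rewrite integral_cst //; congr (_ + _)%E.
  by rewrite -[RHS]mule1 -PD.
rewrite ge0_integral_sum //; last 2 first.
- by move=> l; exact: mg.
- by move=> l x _; rewrite lee_fin mulr_ge0 // /indic ler0n.
apply: eq_bigr => l _.
under eq_integral do rewrite EFinM.
rewrite ge0_integralZl_EFin //.
- by rewrite integral_indic.
- by apply/measurable_EFinP; exact: measurable_indic.
Qed.

Lemma integral_full_set d (T : measurableType d) (R : realType) (P : probability T R)
    (D : set T) (f : T -> R) :
  measurable D -> P D = 1%E -> measurable_fun setT f ->
  (\int[P]_x (f x)%:E = \int[P]_(x in D) (f x)%:E)%E.
Proof.
move=> mD PD mf.
have mf' A : measurable_fun A (EFin \o f).
  by apply/measurable_EFinP; exact: measurable_funTS.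
rewrite -(setUv D) integral_setU //.
- rewrite (null_set_integral (measurableC mD)) ?adde0 //.
  by apply: etrans (probability_setC P mD) _; rewrite PD subee.
- exact: measurableC.
- by apply/disj_setPS; rewrite setICr.
Qed.

(** On the unit interval [f] lies between two step functions with jumps at the quantiles.
    Integrating them weights each increment by the mass of a tail, which is compared with
    [1 - l.+1 / n]; [abel_sum] turns the result into averages. *)
Lemma quantile_sum_bounds (R : realType) (P : probability (measurableTypeR R) R)
    (n : nat) (a : nat -> R) (f : R -> R) :
  P `[0, 1]%classic = 1%E -> (0 < n)%N ->
  a 0%N = 0 -> a n.+1 = 1 -> (forall i, 0 <= a i <= 1) -> (forall i, a i <= a i.+1) ->
  (forall l, (l <= n)%N -> ((1 - l%:R / n%:R)%:E <= P `[a l, 1%R]%classic)%E) ->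
  (forall l, (l <= n)%N -> (P `]a l, 1%R]%classic <= (1 - l%:R / n%:R)%:E)%E) ->
  measurable_fun setT f ->
  (forall s t, s <= t -> 0 <= s -> t <= 1 -> f s <= f t) -> 0 <= f 0 ->
  n%:R^-1 * \sum_(l < n) f (a l) <= \int[P]_x f x <= n%:R^-1 * \sum_(l < n) f (a l.+1).
Proof.
move=> P01 n0 a0 an a01 a_nd qge qle mf f_nd f0.
have mD : measurable (`[0, 1]%classic : set (measurableTypeR R)) by exact: measurable_itv.
have nn0 : n%:R != 0 :> R by rewrite pnatr_eq0 -lt0n.
have f_ge0 x : 0 <= x <= 1 -> 0 <= f x.
  by case/andP=> x0 x1; rewrite (le_trans f0) // f_nd.
have g_ge0 l : 0 <= f (a l.+1) - f (a l).
  by rewrite subr_ge0 f_nd //; [case/andP: (a01 l) | case/andP: (a01 l.+1)].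
have mfE : measurable_fun (`[0, 1]%classic : set (measurableTypeR R)) (EFin \o f).
  by apply/measurable_EFinP; exact: measurable_funTS.
have lower : ((n%:R^-1 * \sum_(l < n) f (a l))%:E <=
    \int[P]_(x in `[0%R, 1%R]) (f x)%:E)%E.
  pose A l : set (measurableTypeR R) := `[a l.+1, +oo[%classic.
  have mA l : measurable (A l) by exact: measurable_itv.
  pose h x := f (a 0%N) + \sum_(l < n) (f (a l.+1) - f (a l)) * \1_(A l) x.
  apply: (@le_trans _ _ (\int[P]_(x in `[0%R, 1%R]) (h x)%:E)%E).
    rewrite (@integral_step _ _ _ P _ (f (a 0%N)) n
      (fun l => f (a l.+1) - f (a l)) A) //; last first.
      by rewrite f_ge0.
    apply: (@le_trans _ _ ((f (a 0%N))%:E + \sum_(l < n)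
        ((f (a l.+1) - f (a l)) * (1 - l.+1%:R / n%:R))%:E)%E).
      rewrite sumEFin (abel_sum (fun l => f (a l))) mulfV // subrr mulr0 sub0r.
      by rewrite -EFinD lee_fin addNKr.
    apply: leeD2l; apply: lee_sum => l _; rewrite EFinM.
    apply: lee_wpmul2l; first by rewrite lee_fin.
    apply: (le_trans (qge l.+1 _)) => //; apply: le_measure; rewrite ?inE //.
      exact: measurableI.
    move=> x /=; rewrite /A /= !in_itv /= => /andP[ax x1].
    rewrite ax x1 andbT; split => //.
    by rewrite (le_trans _ ax) //; case/andP: (a01 l.+1).
  apply: ge0_le_integral => //.
  - move=> x /=; rewrite in_itv /= => x01; rewrite lee_fin addr_ge0 ?f_ge0 //.
    by apply: sumr_ge0 => l _; rewrite mulr_ge0 // /indic ler0n.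
  - apply/measurable_EFinP; apply: measurable_funD => //.
    apply: measurable_sum => l; apply: measurable_funM => //.
  - move=> x /=; rewrite in_itv /= => /andP[x0 x1]; rewrite lee_fin.
    have := @ge_step_sum R f a n x f_nd a01 a_nd; rewrite a0 x0 x1 => /(_ isT).
    rewrite /h a0; congr (_ + _ <= _); apply: eq_bigr => l _; congr (_ * _).
    by rewrite indicE /A mem_setE in_itv /= andbT.
have upper : (\int[P]_(x in `[0%R, 1%R]) (f x)%:E <=
    (n%:R^-1 * \sum_(l < n) f (a l.+1))%:E)%E.
  (* Starting from [a 1] makes the step function dominate [f]; [a n.+1 = 1] ensures that the whole
     interval is covered. *)
  pose b l := a l.+1.
  pose A l : set (measurableTypeR R) := `]b l, +oo[%classic.
  have mA l : measurable (A l) by exact: measurable_itv.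
  pose h x := f (b 0%N) + \sum_(l < n) (f (b l.+1) - f (b l)) * \1_(A l) x.
  apply: (@le_trans _ _ (\int[P]_(x in `[0%R, 1%R]) (h x)%:E)%E); last first.
    rewrite (@integral_step _ _ _ P _ (f (b 0%N)) n
      (fun l => f (b l.+1) - f (b l)) A) //; last 2 first.
    - by rewrite f_ge0 // a01.
    - by move=> l; exact: g_ge0.
    apply: (@le_trans _ _ ((f (b 0%N))%:E + \sum_(l < n)
        ((f (b l.+1) - f (b l)) * (1 - l.+1%:R / n%:R))%:E)%E); last first.
      rewrite sumEFin (abel_sum (fun l => f (b l))) mulfV // subrr mulr0 sub0r.
      by rewrite -EFinD lee_fin addNKr.
    apply: leeD2l; apply: lee_sum => l _; rewrite EFinM.
    apply: lee_wpmul2l; first by rewrite lee_fin g_ge0.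
    apply: (le_trans _ (qle l.+1 _)) => //; apply: le_measure; rewrite ?inE //.
      exact: measurableI.
    by move=> x [] /=; rewrite /A /b /= !in_itv /= andbT => -> /andP[_ ->].
  apply: ge0_le_integral => //.
  - apply/measurable_EFinP; apply: measurable_funD => //.
    apply: measurable_sum => l; apply: measurable_funM => //.
  - move=> x /=; rewrite in_itv /= => /andP[x0 x1]; rewrite lee_fin.
    have b_nd i : b i <= b i.+1 by exact: a_nd.
    have := @le_step_sum R f b n x f_nd (fun i => a01 i.+1) b_nd.
    rewrite x0 /b an x1 => /(_ isT).
    rewrite /h; congr (_ <= _ + _); apply: eq_bigr => l _; congr (_ * _).
    by rewrite indicE /A mem_setE in_itv /= andbT.
rewrite /Rintegral (integral_full_set mD P01 mf).
by move: lower upper; case: (integral _ _ _) => [r| |] //=; rewrite !lee_fin => -> ->.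
Qed.

(** * The sequence of quantiles and its gaps *)

Lemma exists_quantile_seq (R : realType) (P : probability (measurableTypeR R) R)
    (n : nat) :
  P `[0, 1]%classic = 1%E -> (0 < n)%N ->
  exists a : nat -> R,
    [/\ a 0%N = 0, a n.+1 = 1, forall i, 0 <= a i <= 1 & forall i, a i <= a i.+1] /\
    (forall l, (l <= n)%N -> ((1 - l%:R / n%:R)%:E <= P `[a l, 1%R]%classic)%E /\
                             (P `]a l, 1%R]%classic <= (1 - l%:R / n%:R)%:E)%E).
Proof.
move=> P01 n0; have np : (0 : R) < n%:R by rewrite ltr0n.
have q_ex l : exists q : R, (l <= n)%N -> [/\ 0 <= q <= 1,
    ((1 - l%:R / n%:R)%:E <= P `[q, 1%R]%classic)%E &
    (P `]q, 1%R]%classic <= (1 - l%:R / n%:R)%:E)%E].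
  have [ln|] := boolP (l <= n)%N; last by exists 0.
  have [|q hq] := @exists_quantile R P (l%:R / n%:R) P01; last by exists q.
  by rewrite divr_ge0 //= ler_pdivrMr // mul1r ler_nat.
have [q hq] := choice q_ex.
(* The ends are imposed: 0 at index 0, where the tail is the whole unit interval, and 1 beyond
   [n]. *)
pose a l := if l == 0%N then 0 else if (l <= n)%N then q l else 1.
have a0 : a 0%N = 0 by [].
have aq l : (0 < l <= n)%N -> a l = q l.
  by case/andP=> l0 ln; rewrite /a gtn_eqF // ln.
have a1 l : (n < l)%N -> a l = 1.
  by move=> nl; rewrite /a gtn_eqF ?(leq_trans _ nl) // leqNgt nl.
have a01 i : 0 <= a i <= 1.
  have [->|i0] := posnP i; first by rewrite a0 lexx ler01.
  have [i_n|ni] := leqP i n; first by rewrite aq ?i0 //; have [] := hq _ i_n.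
  by rewrite a1 // lexx ler01.
have hP l : (l <= n)%N -> ((1 - l%:R / n%:R)%:E <= P `[a l, 1%R]%classic)%E /\
    (P `]a l, 1%R]%classic <= (1 - l%:R / n%:R)%:E)%E.
  move=> ln; have [->|l0] := posnP l; last by rewrite aq ?l0 //; have [] := hq _ ln.
  by rewrite a0 mul0r subr0; split; rewrite -?P01 // P01 probability_le1.
exists a; split => //; split => // [|i]; first by rewrite a1.
have [ni|i_n] := ltnP n i.+1; first by rewrite [leRHS]a1 //; case/andP: (a01 i).
(* If [a i.+1 < a i], the closed tail at [a i] would be contained in the open tail at [a i.+1],
   whose mass is bounded by a smaller number. *)
rewrite leNgt; apply/negP => lt_a.
have [hi _] := hP _ (ltnW i_n); have [_ hi1] := hP _ i_n.
have : ((1 - i%:R / n%:R)%:E <= (1 - i.+1%:R / n%:R)%:E :> \bar R)%E.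
  apply: le_trans hi (le_trans _ hi1); apply: le_measure; rewrite ?inE //.
  by move=> x /=; rewrite !in_itv /= => /andP[h ->]; rewrite andbT (lt_le_trans lt_a).
by rewrite lee_fin lerD2l lerN2 ler_pM2r ?invr_gt0 // ler_nat ltnn.
Qed.

(** The tail from [a i] has mass at least [1 - i / n], and at most [1 - j / n] of it lies beyond
    [a j]. *)
Lemma quantile_seq_gap (R : realType) (P : probability (measurableTypeR R) R)
    (n : nat) (a : nat -> R) (i j : nat) :
  (forall l, (l <= n)%N -> ((1 - l%:R / n%:R)%:E <= P `[a l, 1%R]%classic)%E /\
                           (P `]a l, 1%R]%classic <= (1 - l%:R / n%:R)%:E)%E) ->
  (i <= j <= n)%N -> (((j - i)%:R / n%:R)%:E <= P `[a i, a j]%classic)%E.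
Proof.
move=> hP /andP[ij jn]; have [hi _] := hP _ (leq_trans ij jn); have [_ hj] := hP _ jn.
have -> : (j - i)%:R / n%:R = (1 - i%:R / n%:R) - (1 - j%:R / n%:R) :> R.
  by rewrite natrB //; ring.
rewrite EFinB leeBlDr // (le_trans hi) // (le_trans (le_probability_cat P _ (a j) _)) //.
exact: leeD2l.
Qed.

(** Consecutive quantiles enclose mass at least [1 / n], hence are at least [min_length] apart, and
    [n] such gaps fit in the unit interval. *)
Lemma min_length_bound (R : realType) (P : probability (measurableTypeR R) R)
    (n : nat) :
  P `[0, 1]%classic = 1%E -> (0 < n)%N -> n%:R * min_length P n%:R^-1 <= 1.
Proof.
move=> P01 n0; set d := min_length _ _.
have [a [[a0 _ a01 a_nd] hP]] := exists_quantile_seq P01 n0.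
have gap i : (i.+1 < n.+1)%N -> a i + d <= a i.+1.
  move=> i_n; rewrite -lerBrDl -[leRHS]ger0_norm ?subr_ge0 // distrC.
  apply: min_length_le; have := @quantile_seq_gap R P n a i i.+1 hP.
  by rewrite leqnSn subSnn mul1r; apply.
have := @separated_le R d a n.+1 gap 0%N n.
rewrite leq0n ltnSn subn0 a0 add0r => /(_ isT) h.
by rewrite (le_trans h) //; case/andP: (a01 n).
Qed.

(** * Transversals of index blocks and the size of [n] *)

Lemma sum_blocks (V : nmodType) (F : nat -> V) k m :
  \sum_(i < k * m) F i = \sum_(b < k) \sum_(s < m) F (b * m + s)%N.
Proof.
elim: k => [|k IH]; first by rewrite mul0n !big_ord0.
by rewrite mulSnr big_split_ord /= IH big_ord_recr.
Qed.

(** Indices in [[m, k.+1 * m)] are written [b.+1 * m + s]; summing over [b] first groups them by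
    transversal [s]. *)
Lemma sum_shifted_blocks (V : nmodType) (F : nat -> V) k m n :
  (0 < m)%N -> (k.+1 * m <= n.+1)%N ->
  (forall l, ~~ (m <= l < k.+1 * m)%N -> F l = 0) ->
  \sum_(i < n) F i.+1 = \sum_(s < m) \sum_(b < k) F (b.+1 * m + s)%N.
Proof.
move=> m0 mn F0; rewrite exchange_big /=.
have -> : \sum_(i < n) F i.+1 = \sum_(0 <= l < n.+1) F l.
  by rewrite big_mkord big_ord_recl /= F0 ?add0r // leqNgt m0.
have mk : (m <= k.+1 * m)%N by rewrite mulSn leq_addr.
rewrite (@big_cat_nat _ _ _ m) ?(leq_trans mk) //=.
have -> : \sum_(0 <= l < m) F l = 0.
  by rewrite big_nat big1 // => l /andP[_ lm]; rewrite F0 // leqNgt lm.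
rewrite add0r (@big_cat_nat _ _ _ (k.+1 * m)) //=.
have -> : \sum_(k.+1 * m <= l < n.+1) F l = 0.
  by rewrite big_nat big1 // => l /andP[lm _]; rewrite F0 // [(l < _)%N]ltnNge lm andbF.
rewrite addr0.
rewrite -{1}[m]add0n big_addn mulSn addKn big_mkord.
rewrite (sum_blocks (fun i => F (i + m)%N)).
apply: eq_bigr => b _; apply: eq_bigr => s _; congr F.
by rewrite mulSn; ring.
Qed.

(** With [k = j + 1], the bound [rh <= 1] makes the second factor of the radius at most [12^-j],
    hence at most [1 / k]. *)
Lemma radius_large_n (R : realType) (n j : nat) (rh : R) :
  0 <= rh <= 1 ->
  1 <= n%:R * (rh / (6 * (j.+1 + 3)%:R) * (rh / (12 * expR 1)) ^+ j) ->
  (6 * (j.+1 + 3) * j.+1 <= n)%N.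
Proof.
move=> /andP[rh0 rh1] h1.
have E1 : (1 : R) <= expR 1 by rewrite (le_trans _ (expR_ge1Dx _)) // lerDl.
have E0 : (0 : R) < expR 1 by exact: expR_gt0.
have j12 : j.+1%:R <= 12 ^+ j :> R.
  rewrite -natrX ler_nat; elim: j {h1} => // j IH.
  by rewrite expnS; move: IH; move: (12 ^ j)%N; lia.
have h2 : (rh / (12 * expR 1)) ^+ j <= j.+1%:R^-1.
  apply: (@le_trans _ _ (12^-1 ^+ j)).
    have x0 : 0 <= rh / (12 * expR 1) by rewrite divr_ge0 // mulr_ge0 // ltW.
    rewrite lerXn2r ?nnegrE // ler_pdivrMr ?mulr_gt0 // mulrA mulVf // mul1r.
    exact: le_trans rh1 E1.
  by rewrite exprVn lef_pV2 ?posrE ?exprn_gt0.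
have h3 : rh / (6 * (j.+1 + 3)%:R) <= (6 * (j.+1 + 3)%:R)^-1.
  by rewrite ler_piMl // invr_ge0 mulr_ge0.
have h4 : 1 <= n%:R * ((6 * (j.+1 + 3)%:R)^-1 * j.+1%:R^-1) :> R.
  rewrite (le_trans h1) // ler_wpM2l // ler_pM // ?divr_ge0 ?mulr_ge0 //.
  by rewrite exprn_ge0 // divr_ge0 // mulr_ge0 // ltW.
move: h4; rewrite -invfM ler_pdivlMr ?mul1r ?mulr_gt0 ?ltr0n //.
by rewrite -!natrM ler_nat.
Qed.

(** Divided by [n (k + 3)], the conclusion says that mass at least [1 / (k + 3)] remains above the
    quantile of index [l]. The lower bound on [n] absorbs the rounding in [m]. *)
Lemma quantile_index_bound (k n m l : nat) :
  (6 * (k + 3) * k <= n)%N -> (m * (k + 3) <= n + k + 2)%N -> (l < k.+1 * m)%N ->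
  (l * (k + 3) + n <= n * (k + 3))%N.
Proof.
move=> hn hm hl.
have : (l.+1 * (k + 3) <= k.+1 * (n + k + 2))%N.
  by rewrite (leq_trans (leq_mul hl (leqnn _))) // -mulnA leq_mul.
by move: hn; clear; nia.
Qed.

Lemma block_index_bounds (k m b s : nat) :
  (b < k)%N -> (s < m)%N -> (m <= b.+1 * m + s < k.+1 * m)%N.
Proof.
move=> bk sm; rewrite mulSn -addnA leq_addr (@leq_trans (b.+2 * m)) //.
  by rewrite 2!mulSn ltn_add2l addnC ltn_add2r.
by rewrite leq_mul2r ltnS bk orbT.
Qed.

(* The coordinate p_j, 1 <= j <= k, is p 0 i with j = i.+1.
   The inverse of the radius is taken in \bar R, where 0^-1 = +oo. *)
Theorem theorem1p3 (R : realType) (sigma : probability (measurableTypeR R) R)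
    (hsigma : sigma `[0, 1]%classic = 1%E)
    (k : nat) (hk : (2 <= k)%N)
    (n : nat) (hn : ((moment_radius sigma k)%:E^-1 <= n%:R%:E)%E)
    (p : 'rV[R]_k)
    (hp : forall j : 'I_k,
      `|p 0 j - \int[sigma]_x (x ^+ j.+1)| <= moment_radius sigma k) :
  exists x : 'I_n -> R,
    (forall i, 0 <= x i <= 1) /\
    (forall j : 'I_k, n%:R^-1 * (\sum_(i < n) x i ^+ j.+1) = p 0 j).
Proof.
have E0 : (0 : R) < expR 1 by exact: expR_gt0.
case: k hk hn p hp => // j; rewrite ltnS => j0 hn p hp.
set r := moment_radius sigma j.+1 in hn hp.
pose d := min_length sigma (j.+1 + 3)%:R^-1.
have rhoE : rho sigma j.+1 = j%:R * d by rewrite /rho -natr1 addrK.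
have rE : r = j%:R * d / (6 * (j.+1 + 3)%:R) * (j%:R * d / (12 * expR 1)) ^+ j.
  by rewrite /r /moment_radius rhoE subn1.
(* Otherwise the radius is 0, its inverse is infinite, and no [n] satisfies [hn]. *)
have d0 : 0 < d.
  rewrite lt_neqAle eq_sym min_length_ge0 andbT; apply: contraTneq hn => d_eq0.
  by rewrite rE d_eq0 mulr0 mul0r mul0r inve0 leye_eq.
have jR : (0 : R) < j%:R by rewrite ltr0n.
have rho1 : j%:R * d <= 1.
  have := @min_length_bound R sigma (j.+1 + 3) hsigma isT; rewrite -/d.
  by apply: le_trans; rewrite ler_wpM2r ?ler_nat ?(ltW d0) //; lia.
have r0 : 0 < r by rewrite rE !(mulr_gt0, divr_gt0, exprn_gt0).
have nr1 : 1 <= n%:R * r.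
  by move: hn; rewrite inver gt_eqF // lee_fin -ler_pdivrMr // div1r.
have n0 : (0 < n)%N.
  by rewrite lt0n; apply: contraTneq nr1 => ->; rewrite mul0r -ltNge.
have nR : (0 : R) < n%:R by rewrite ltr0n.
have n_big : (6 * (j.+1 + 3) * j.+1 <= n)%N.
  apply: (@radius_large_n R _ _ (j%:R * d)); last by rewrite -rE.
  by rewrite rho1 mulr_ge0 // ltW.
(* With [k = j + 1], this is the ceiling of [n / (k + 3)]. *)
pose m := ((n + j.+1 + 2) %/ (j.+1 + 3))%N.
have m_lo : (n <= m * (j.+1 + 3))%N.
  by have := @ltn_ceil (n + j.+1 + 2) (j.+1 + 3) isT; rewrite -/m; clear; lia.
have m_hi : (m * (j.+1 + 3) <= n + j.+1 + 2)%N by exact: leq_trunc_div.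
have m0 : (0 < m)%N.
  by rewrite lt0n; apply: contraTneq m_lo => ->; rewrite mul0n -ltnNge.
have idx l : (l < j.+2 * m)%N -> (l * (j.+1 + 3) + n <= n * (j.+1 + 3))%N.
  exact: quantile_index_bound n_big m_hi.
have idx_n l : (l < j.+2 * m)%N -> (l <= n)%N.
  by move=> /idx; clear; nia.
have mR : (0 : R) < m%:R by rewrite ltr0n.
have [a [[a0 an a01 a_nd] aP]] := exists_quantile_seq hsigma n0.
(* Indices [m] apart enclose mass at least [m / n >= 1 / (k + 3)]. *)
have gap i i' : (i + m <= i')%N -> (i' <= n)%N -> a i + d <= a i'.
  move=> imi' i'n; have le_ii' : (i <= i')%N by rewrite (leq_trans _ imi') ?leq_addr.
  have mii' : (m <= i' - i)%N by rewrite leq_subRL.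
  have ii' : (i <= i' <= n)%N by rewrite le_ii'.
  have a_le : a i <= a i' by apply: (@homo_leq _ a <=%R) => //; exact: le_trans.
  rewrite -lerBrDl -[leRHS]ger0_norm ?subr_ge0 // distrC.
  apply: min_length_le; apply: le_trans (quantile_seq_gap aP ii').
  rewrite lee_fin ler_pdivlMr // ler_pdivrMl ?ltr0n // -natrM ler_nat.
  by rewrite (leq_trans m_lo) // mulnC leq_mul2l mii' orbT.
have gap1 l : (l < j.+2 * m)%N -> a l + d <= 1.
  move=> lm; have [h _] := aP _ (idx_n _ lm).
  rewrite -lerBrDl -[leRHS]ger0_norm ?subr_ge0; last by case/andP: (a01 l).
  rewrite distrC; apply: min_length_le; apply: le_trans h.
  rewrite lee_fin -[X in X - _](@mulfV _ n%:R) ?gt_eqF // -mulrBl -natrB ?idx_n //.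
  rewrite ler_pdivlMr // ler_pdivrMl ?ltr0n // -natrM ler_nat mulnBr.
  by have := idx _ lm; clear; lia.
(* The defect of each power sum is shared equally among the [m] transversals; [insub] extends the
   vector by 0 beyond its [k] entries. *)
pose c i : R := oapp (fun i : 'I_j.+1 =>
  (n%:R * p 0 i - \sum_(l < n) a l.+1 ^+ i.+1) / m%:R) 0 (insub i).
have cE (i : 'I_j.+1) : c i = (n%:R * p 0 i - \sum_(l < n) a l.+1 ^+ i.+1) / m%:R.
  by rewrite /c valK.
pose e := j%:R * d / 3 * (j%:R * d / (12 * expR 1)) ^+ j.
have eE : e = 2 * r * (j.+1 + 3)%:R.
  by rewrite /e rE; field; rewrite !gt_eqF // ltr0n.
(* The total defect is at most [1 + n r <= 2 n r <= 2 (k + 3) m r], that is [m * e]. *)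
have c_le i : (i < j.+1)%N -> `|c i| <= e.
  move=> ij; rewrite (cE (Ordinal ij)) normrM normfV (ger0_norm (ltW mR)).
  rewrite ler_pdivrMr //; set i' := Ordinal ij.
  (* The sums over [a 0, ..., a n.-1] and over [a 1, ..., a n] enclose [n] times the moment and
     differ by a power of [a n], at most 1. *)
  have hint : `|n%:R * (\int[sigma]_x (x ^+ i'.+1)) - \sum_(l < n) a l.+1 ^+ i'.+1| <= 1.
    have := @quantile_sum_bounds R sigma n a (fun x => x ^+ i'.+1)
      hsigma n0 a0 an a01 a_nd (fun l h => (aP l h).1) (fun l h => (aP l h).2).
    set I := Rintegral _ _ _; set S1 := \sum_(l < n) a l.+1 ^+ _.
    have -> : \sum_(l < n) a l ^+ i'.+1 = S1 - a n ^+ i'.+1.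
      apply: (addIr (a n ^+ i'.+1)); rewrite subrK.
      transitivity (\sum_(l < n.+1) a l ^+ i'.+1); first by rewrite big_ord_recr.
      by rewrite big_ord_recl a0 expr0n add0r.
    have mX : measurable_fun setT (fun x : measurableTypeR R => x ^+ i'.+1).
      exact: measurable_funX.
    have X_nd s t : s <= t -> 0 <= s -> t <= 1 -> s ^+ i'.+1 <= t ^+ i'.+1 :> R.
      by move=> st s0 _; rewrite lerXn2r ?nnegrE // (le_trans s0).
    move=> /(_ mX X_nd); rewrite expr0n lexx => /(_ isT).
    have an1 : a n ^+ i'.+1 <= 1 by case/andP: (a01 n) => ? ?; rewrite exprn_ile1.
    rewrite ler_pdivrMl // ler_pdivlMl // ler_norml => /andP[h1 h2].
    by move: h1 h2 an1; set u := a n ^+ _; clearbody u S1 I; lra.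
  have -> : n%:R * p 0 i' - \sum_(l < n) a l.+1 ^+ i'.+1 =
      n%:R * (p 0 i' - \int[sigma]_x (x ^+ i'.+1)) +
      (n%:R * (\int[sigma]_x (x ^+ i'.+1)) - \sum_(l < n) a l.+1 ^+ i'.+1) by ring.
  rewrite (le_trans (ler_normD _ _)) // normrM normr_nat.
  have hpi : n%:R * `|p 0 i' - \int[sigma]_x (x ^+ i'.+1)| <= n%:R * r.
    by rewrite ler_pM2l.
  have nm : n%:R * r <= (j.+1 + 3)%:R * m%:R * r.
    by rewrite ler_pM2r // -natrM ler_nat mulnC.
  rewrite eE; move: hint hpi nm nr1; set u := `|_ - _|; set v := n%:R * `|_|.
  by clearbody u v; lra.
have w_ex s : exists w : nat -> R, (s < m)%N ->
    (forall b, (b < j.+1)%N -> 0 <= w b <= 1) /\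
    (forall i, (i < j.+1)%N -> \sum_(b < j.+1) w b ^+ i.+1 =
       \sum_(b < j.+1) a (b.+1 * m + s)%N ^+ i.+1 + c i).
  have [sm|] := boolP (s < m)%N; last by exists (fun=> 0).
  have lt_idx b : (b < j.+1)%N -> (b.+1 * m + s < j.+2 * m)%N.
    by move=> bj; case/andP: (block_index_bounds bj sm).
  have e01 : 0 <= e <= 1.
    have E1 : (1 : R) <= expR 1 by rewrite (le_trans _ (expR_ge1Dx _)) // lerDl.
    have jd0 : 0 <= j%:R * d by rewrite mulr_ge0 // ltW.
    have t0 : 0 <= j%:R * d / (12 * expR 1) by rewrite divr_ge0 // mulr_ge0 // ltW.
    apply/andP; split; first by rewrite mulr_ge0 ?exprn_ge0 // divr_ge0.
    rewrite mulr_ile1 ?exprn_ge0 ?divr_ge0 //; first by lra.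
    by rewrite exprn_ile1 // ler_pdivrMr ?mulr_gt0 //; lra.
  have [] := @move_power_sums R j.+1 d e (fun b => a (b.+1 * m + s)%N) c.
  - by [].
  - by [].
  (* The lowest point of a transversal has index at least [m], so it is [d] away from [a 0 = 0]. *)
  - by rewrite -[d]add0r -a0 gap ?idx_n ?lt_idx // mul1n leq_addr.
  - exact/gap1/lt_idx.
  - by move=> b bj; rewrite gap ?idx_n ?lt_idx // addnAC -mulSnr.
  - exact: e01.
  - exact: c_le.
  - by move=> l lj; rewrite /e; exact: fact_mul_gt.
  by move=> w hw; exists w.
have [w hw] := choice w_ex.
(* Index [b.+1 * m + s] receives the moved point [w s b]; indices outside the blocks keep their
   quantile. *)
pose X l := if (m <= l < j.+2 * m)%N then w (l %% m)%N (l %/ m).-1 else a l.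
have X_block b s : (b < j.+1)%N -> (s < m)%N -> X (b.+1 * m + s)%N = w s b.
  move=> bj sm; rewrite /X ifT ?block_index_bounds //.
  by rewrite modnMDl modn_small // divnMDl // divn_small // addn0.
exists (fun i : 'I_n => X i.+1); split=> [i|i].
  rewrite /X; move: i.+1 => l; case: ifP => // /andP[ml lm].
  apply: (hw _ (ltn_pmod _ m0)).1.
  have : (l %/ m < j.+2)%N by rewrite ltn_divLR.
  have : (0 < l %/ m)%N by rewrite divn_gt0.
  by case: (l %/ m)%N.
(* Each of the [m] transversals contributes a shift [c i], and [m * c i] is exactly the defect. *)
have -> : \sum_(l < n) X l.+1 ^+ i.+1 = \sum_(l < n) a l.+1 ^+ i.+1 + m%:R * c i.
  rewrite -[LHS](subrK (\sum_(l < n) a l.+1 ^+ i.+1)) addrC -sumrB; congr (_ + _).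
  rewrite (@sum_shifted_blocks _ (fun l => X l ^+ i.+1 - a l ^+ i.+1) j.+1 m n) //.
  - rewrite -[m in m%:R]card_ord mulr_natl -sumr_const; apply: eq_bigr => s _.
    rewrite sumrB; apply/eqP; rewrite subr_eq addrC -((hw _ (ltn_ord s)).2 i) //.
    by apply/eqP; apply: eq_bigr => b _; rewrite X_block.
  - by have := @idx_n (j.+2 * m).-1; rewrite prednK ?muln_gt0 //; lia.
  - by move=> l hl; rewrite /X (negPf hl) subrr.
by rewrite cE mulrCA mulfV ?gt_eqF // mulr1 addrC subrK mulKf // gt_eqF.
Qed.
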